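(* For any $0<\tau<\infty$, there exists a dynamical system $(X,f)$ with the non-uniform $\tau$-specification property such that: (1) there exist two disjoint non-empty compact subsets $K,L\subset\mathcal{M}_f(X)$ and a distal pair $\{p_0,p_1\}\subset X$ such that $K$ can be written as a union $K=\bigcup_{i\in I}K_i$, where each $K_i$ is a non-empty connected closed set with $G_{K_i}\neq\varnothing$; (2) (for these $K,L,p_0,p_1$) for any $\mu\in\overline{\mathrm{co}}(K\cup V_f(p_0)\cup V_f(p_1))$ and any $\nu\in L$, one has $$\rho_{\mathsf{tv}}(\mu,\nu)\geq\frac{\tau}{1+\tau},$$ and moreover, equality holds for some $(\mu,\nu)\in\overline{\mathrm{co}}(K\cup V_f(p_0)\cup V_f(p_1))\times L$; (3) $G^K\setminus\bigcup_{\nu\in L}G^{\nu}$ has no DC1-scrambled pairs.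
   Context: A dynamical system $(X,f)$ consists of a compact metric space $(X,d)$ with at least two points and a continuous map $f:X\to X$. $\mathbb{N}$ denotes the positive integers. $\mathcal{M}(X)$ and $\mathcal{M}_f(X)$ are the spaces of Borel probability measures and of $f$-invariant Borel probability measures on $X$, with the weak* topology; $\mathfrak{B}(X)$ is the Borel $\sigma$-algebra. $\overline{\mathrm{co}}$ denotes the (weak* ) closed convex hull. Non-uniform specification property: $(X,f)$ satisfies the non-uniform specification property with gap function $M(n,\varepsilon):\mathbb{N}\times(0,+\infty)\to\mathbb{N}$ if (i) $M(n,\varepsilon)$ is non-decreasing in $n$ and non-increasing in $\varepsilon$; (ii) for every $\varepsilon>0$, any integer $k\ge2$, any $x_1,\dots,x_k\in X$ and any non-negative integers $a_1\le b_1<a_2\le b_2<\cdots<a_k\le b_k$ with $a_{i+1}-b_i\ge M(b_i-a_i+1,\varepsilon)$ for $1\le i\le k-1$, there exists $z\in X$ such that $d(f^{n-a_i}x_i,f^nz)\le\varepsilon$ for all $a_i\le n\le b_i$ and $1\le i\le k$. Non-uniform $\tau$-specification property: let $\mathscr{G}(X,f)$ be the collection of all gap functions for which $(X,f)$ satisfies the non-uniform specification property, and for $M\in\mathscr{G}(X,f)$ let $\tau(M)=\sup_{\varepsilon>0}\liminf_{n\to\infty}\frac{M(n,\varepsilon)}{n}$. $(X,f)$ satisfies the non-uniform $\tau$-specification property if there is $M\in\mathscr{G}(X,f)$ with $\tau(M)=\tau$ and every $M'\in\mathscr{G}(X,f)$ satisfies $\tau(M')\ge\tau$. For $x\in X$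 and $n\in\mathbb{N}$ let $\delta_x^n=\frac1n\sum_{k=0}^{n-1}\delta_{f^kx}$, and let $V_f(x)$ be the set of weak* accumulation points of $\{\delta_x^n\}_{n\ge1}$. For non-empty $K\subset\mathcal{M}_f(X)$, $G^K=\{x\in X:V_f(x)\supset K\}$, and $G^\nu=G^{\{\nu\}}$. For non-empty compact connected $K\subset\mathcal{M}_f(X)$, $G_K=\{x\in X:V_f(x)=K\}$. The total variation distance on $\mathcal{M}(X)$ is $\rho_{\mathsf{tv}}(\mu,\nu)=\sup_{B\in\mathfrak{B}(X)}|\mu(B)-\nu(B)|$. A pair $\{p_0,p_1\}\subset X$ is distal if $\inf_{n\ge0}d(f^np_0,f^np_1)>0$. A pair $\{x,y\}$ is DC1-scrambled if for every $t>0$, $\limsup_{n\to\infty}\frac1n|\{j\in[0,n-1]:d(f^jx,f^jy)<t\}|=1$, and there exists $t_0>0$ such that $\liminf_{n\to\infty}\frac1n|\{j\in[0,n-1]:d(f^jx,f^jy)<t_0\}|=0$ (here $j$ ranges over integers). *)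

(* Defs.v *)
(* MathComp-Analysis, over an arbitrary R : realType *)
From HB Require Import structures.
From mathcomp Require Export all_boot all_order all_algebra.
From mathcomp Require Export all_classical all_reals all_analysis.

Set Implicit Arguments.
Unset Strict Implicit.
Unset Printing Implicit Defensive.

Import Order.TTheory GRing.Theory Num.Theory.
Import numFieldNormedType.Exports.

Local Open Scope classical_set_scope.
Local Open Scope ring_scope.

(* Measurable types of the library are pointed; a space with at least two
   points can always be pointed. *)
#[short(type="pmetricType")]
HB.structure Definition PointedMetric (K : numDomainType) :=
  { M of Metric K M & Pointed M }.

Definition borel (X : ptopologicalType) := g_sigma_algebraType (@open X).

HB.instance Definition _ (X : ptopologicalType) := Measurable.on (borel X).

Section Measures.
Context {R : realType} {X : ptopologicalType}.

(* A [probability] is a function on all subsets of X, so one Borel probability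
   measure has several representatives, differing on non-measurable sets only.
   They are topologically indistinguishable below, so that closed sets contain
   all the representatives of their elements ([closed_borel_prob]).  Compact
   sets of measures are to be taken closed (automatic in the Hausdorff quotient):
   disjoint closed sets then have no Borel measure in common. *)
Definition borel_prob : Type := probability (borel X) R.

Definition test_fun : Type := {phi : X -> R | continuous phi}.

Definition pairing (mu : borel_prob) : {ptws test_fun -> R} :=
  fun phi => Rintegral (mu : probability (borel X) R) setT (sval phi).

HB.instance Definition _ := Choice.on borel_prob.

(* The weak* topology: the coarsest one making every mu |-> \int phi dmu,
   phi continuous, continuous. *)
HB.instance Definition _ :=
  Topological.copy borel_prob (initial_topology pairing).

Lemma closed_borel_prob (A : set borel_prob) (mu nu : borel_prob) :
  closed A -> (forall B : set (borel X), measurable B -> mu B = nu B) ->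
  A mu -> A nu.
Proof.
move=> clA munu Amu.
have pE : pairing mu = pairing nu.
  apply/funext => phi; rewrite /pairing /Rintegral; congr fine.
  by apply: eq_measure_integral => B mB _; exact: munu.
apply: clA => U; rewrite nbhsE => -[V [[W oW WV] Vnu] VU].
by exists mu; split => //; apply: VU; rewrite -WV /preimage/= pE; rewrite -WV in Vnu.
Qed.

Definition mix (t : {i01 R}) (mu nu : borel_prob) : set (borel X) -> \bar R :=
  measure_add (mscale t%:num%:nng (mu : probability (borel X) R))
    (mscale (1 - t%:num)%:nng (nu : probability (borel X) R)).

Section mix_probability.
Variables (t : {i01 R}) (mu nu : borel_prob).

HB.instance Definition _ := Measure.on (mix t mu nu).

Let mixT : mix t mu nu setT = 1%E.
Proof.
have pT (P : borel_prob) : P [set: borel X] = 1%E by exact: probability_setT.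
have -> : mix t mu nu setT =
    (t%:num%:E * mu [set: borel X] + (1 - t%:num)%:E * nu [set: borel X])%E.
  exact: measure_addE.
rewrite !pT !mule1 -EFinD.
by rewrite addrC subrK.
Qed.

HB.instance Definition _ := Measure_isProbability.Build _ _ _ (mix t mu nu) mixT.

End mix_probability.

Definition convex_measures (A : set borel_prob) :=
  forall (t : {i01 R}) mu nu, A mu -> A nu -> A (mix t mu nu : borel_prob).

Definition closed_convex_hull (A : set borel_prob) : set borel_prob :=
  smallest [set B | closed B /\ convex_measures B] A.

Definition tv_dist (mu nu : borel_prob) : \bar R :=
  ereal_sup [set `|mu B - nu B|%E | B in (measurable : set (set (borel X)))].

Definition invariant_measures (f : X -> X) : set borel_prob :=
  [set mu | forall B : set (borel X), measurable B -> mu (f @^-1` B) = mu B].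

(* Shifted index: [empirical f x n] is the average of the Dirac masses at the
   n.+1 points x, ..., f^n x. *)
Definition empirical (f : X -> X) (x : X) (n : nat) : set (borel X) -> \bar R :=
  mscale (n.+1%:R^-1)%:nng
    (msum (fun k => \d_(iter k f x : borel X)) n.+1).

Section empirical_probability.
Variables (f : X -> X) (x : X) (n : nat).

HB.instance Definition _ := Measure.on (empirical f x n).

Let empiricalT : empirical f x n setT = 1%E.
Proof.
rewrite /empirical /mscale/= /msum.
under eq_bigr do rewrite /= diracT.
by rewrite sumEFin -EFinM sumr_const card_ord mulVf.
Qed.

HB.instance Definition _ :=
  Measure_isProbability.Build _ _ _ (empirical f x n) empiricalT.

End empirical_probability.

Definition limit_measures (f : X -> X) (x : X) : set borel_prob :=
  cluster ((fun n => empirical f x n : borel_prob) @ \oo).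

(* Usually written G^K, and G_K for [saturated_set]. *)
Definition supersaturated_set (f : X -> X) (K : set borel_prob) : set X :=
  [set x | K `<=` limit_measures f x].

Definition saturated_set (f : X -> X) (K : set borel_prob) : set X :=
  [set x | limit_measures f x = K].

End Measures.

Arguments borel_prob R X : clear implicits.

Section Dynamics.
Context {R : realType} {X : pmetricType R}.
Implicit Types (f : X -> X) (M : nat -> R -> nat) (eps : R).

Definition dynamical_system f :=
  [/\ compact [set: X], exists x y : X, x <> y & continuous f].

(* M n eps only matters for 0 < n and 0 < eps.  The indices 1, ..., k of the
   orbit segments are shifted to 0, ..., k - 1. *)
Definition gap_function f M :=
  [/\ forall n eps, (0 < n)%N -> 0 < eps -> (0 < M n eps)%N,
      forall n m eps, (0 < n)%N -> (n <= m)%N -> 0 < eps ->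
        (M n eps <= M m eps)%N,
      forall n eps eps', (0 < n)%N -> 0 < eps -> eps <= eps' ->
        (M n eps' <= M n eps)%N &
      forall eps, 0 < eps ->
      forall (k : nat) (x : nat -> X) (a b : nat -> nat), (2 <= k)%N ->
        (forall i, (i < k)%N -> (a i <= b i)%N) ->
        (forall i, (i.+1 < k)%N -> (b i < a i.+1)%N) ->
        (forall i, (i.+1 < k)%N ->
           (M (b i - a i + 1)%N eps <= a i.+1 - b i)%N) ->
        exists z : X, forall i n, (i < k)%N -> (a i <= n <= b i)%N ->
          mdist (iter (n - a i) f (x i)) (iter n f z) <= eps].

(* The value 0 of the quotient at n = 0 does not affect the lower limit. *)
Definition gap_rate M : \bar R :=
  ereal_sup [set limn_einf (fun n => ((M n eps)%:R / n%:R)%:E)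
            | eps in [set eps : R | 0 < eps]].

Definition nonuniform_specification f (tau : R) :=
  exists2 M, gap_function f M &
    gap_rate M = tau%:E /\
    forall M', gap_function f M' -> (tau%:E <= gap_rate M')%E.

Definition distal_pair f (p0 p1 : X) :=
  0 < inf (range (fun n => mdist (iter n f p0) (iter n f p1))).

(* The value 0 at n = 0 does not affect upper and lower limits. *)
Definition close_frequency f (x y : X) (t : R) (n : nat) : \bar R :=
  (#|[pred j : 'I_n | mdist (iter j f x) (iter j f y) < t]|%:R / n%:R)%:E.

Definition DC1_scrambled f (x y : X) :=
  (forall t, 0 < t -> limn_esup (close_frequency f x y t) = 1%E) /\
  exists2 t0, 0 < t0 & limn_einf (close_frequency f x y t0) = 0%E.

End Dynamics.

(* Main.v *)
From HB Require Import structures.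
Require Import Defs.
From mathcomp Require Import zify ring lra measurable_realfun.

Set Implicit Arguments.
Unset Strict Implicit.
Unset Printing Implicit Defensive.

Import Order.TTheory GRing.Theory Num.Theory.
Import numFieldNormedType.Exports.

Local Open Scope classical_set_scope.
Local Open Scope ring_scope.

(* X is the one-sided subshift of all 0-1 sequences in which every run 1^n
   followed by a 0 is followed by 0s for a time at least tau n.  A finite word
   can be continued freely after about tau n zeros, n its length, and after 1^n
   no shorter gap is possible, so tau is the optimal rate.  Let K be the Dirac
   mass at 1^oo.  If it is an accumulation point of the empirical measures of x
   and x is not eventually 1, then x has prefixes that consist, up to a
   negligible part, of a run 1^n followed by tau n zeros; hence
   nu = (delta_{1^oo} + tau delta_{0^oo}) / (1 + tau) is an accumulation point
   as well.  With L = {nu}, only eventually constant points remain in (3).  For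
   p0 = 1^oo and p1 = (1 0^(c-1))^oo with c > tau + 1, the block 0^c has measure
   0 for all measures of the closed convex hull, and tau / (1 + tau) for nu. *)

(** * The weak* topology *)

Section WeakTopology.
Context {R : realType} {X : ptopologicalType}.
Implicit Types (mu nu : borel_prob R X) (phi : test_fun (R := R) (X := X)).

Lemma continuous_pairing phi : continuous (fun mu => pairing mu phi).
Proof.
move=> mu; apply: (@continuous_comp _ _ _ (pairing (R := R) (X := X))
  (fun g : {ptws _ -> R} => g phi)).
  exact: initial_continuous.
exact: (@proj_continuous {classic test_fun} (fun=> R) phi).
Qed.

(** Neighbourhoods are pulled back along [pairing] from a product space, where convergence is
    coordinatewise. *)
Lemma cvg_borel_prob (F : set_system (borel_prob R X)) mu : Filter F ->
  (forall phi, (fun nu => pairing nu phi) @ F --> pairing mu phi) -> F --> mu.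
Proof.
move=> FF cvF U; rewrite nbhsE => -[V [[W oW WV] Vmu] VU].
have cvF' : (pairing @ F) --> (pairing mu : {ptws test_fun -> R}).
  apply/cvg_sup => phi A [B [[C oC <-] Cmu] sBA].
  have FC : F [set nu | C (pairing nu phi)].
    exact: cvF phi _ (open_nbhs_nbhs (conj oC Cmu)).
  by apply: (@filterS _ F FF _ (@pairing R X @^-1` A) _ FC) => nu Cnu; exact: sBA.
have nW : nbhs (pairing mu) W.
  by apply: open_nbhs_nbhs; split => //; rewrite -WV in Vmu.
have := cvF' _ nW; rewrite /= /nbhs/= => FW.
by apply: filterS FW => nu; rewrite -WV in VU; exact: VU.
Qed.

(* The class of mu in the Hausdorff quotient of the space of measures. *)
Definition indist mu : set (borel_prob R X) := [set nu | pairing nu = pairing mu].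

Lemma indist_nbhs mu nu (U : set (borel_prob R X)) :
  indist mu nu -> nbhs mu U -> nbhs nu U.
Proof.
move=> munu; rewrite !nbhsE => -[V [[W oW WV] Vmu] VU].
exists V => //; split; first by exists W.
by rewrite -WV /preimage /= munu; rewrite -WV in Vmu.
Qed.

Lemma indist_closed mu : closed (indist mu).
Proof.
move=> nu clnu; apply/funext => phi; apply: contrapT => /eqP ne.
have [A [B]] : exists A B : set R,
    [/\ nbhs (pairing nu phi) A, nbhs (pairing mu phi) B & A `&` B = set0].
  apply: contrapT => h; move/negP: ne; apply; apply/eqP.
  apply: norm_hausdorff => A B nA nB; apply/set0P/eqP => AB0.
  by apply: h; exists A, B; split.
move=> [nA nB AB0]; have [th []] := clnu _ (continuous_pairing nA).
move=> /(congr1 (fun g => g phi)) e /=; rewrite e => Amu.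
have : (A `&` B) (pairing mu phi) by split => //; exact: nbhs_singleton.
by rewrite AB0.
Qed.

(** All members of the class have the same neighbourhoods, so a proper filter containing the class
    clusters at [mu]. *)
Lemma indist_compact mu : compact (indist mu).
Proof.
move=> F PF FK; exists mu; split => // A B FA nB.
have [nu [Anu mnu]] := @filter_ex _ _ PF _ (filterI FA FK).
by exists nu; split => //; apply: nbhs_singleton; exact: indist_nbhs nB.
Qed.

(** An open set that meets the class contains it, so a non-empty relatively open part is the whole
    class. *)
Lemma indist_connected mu : connected (indist mu).
Proof.
move=> B [nu Bnu] [C oC BE] _; rewrite BE; apply/seteqP; split=> [th []//|th mth].
split=> //; apply: nbhs_singleton.
have [mnu Cnu] : (indist mu `&` C) nu by rewrite -BE.
apply: (@indist_nbhs nu) => //; last exact: open_nbhs_nbhs.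
by rewrite /indist /= mth mnu.
Qed.

Lemma limit_measures_subseq (f : X -> X) x mu (T : nat -> nat) :
  T @ \oo --> \oo ->
  (forall phi,
    (fun k => pairing (empirical f x (T k)) phi) @ \oo --> pairing mu phi) ->
  limit_measures f x mu.
Proof.
move=> Too cv A B FA nB.
have cT : (fun k => empirical f x (T k) : borel_prob R X) @ \oo --> mu.
  by apply: cvg_borel_prob => phi; exact: cv.
have FB : \forall k \near \oo, B (empirical f x (T k)) by exact: (cT _ nB).
have FA' : \forall k \near \oo, A (empirical f x (T k)) by exact: (Too _ FA).
have [k [? ?]] := filter_ex (filterI FB FA').
by exists (empirical f x (T k) : borel_prob R X).
Qed.

Lemma limit_measures_frequently (f : X -> X) x mu phi (D : set R) N :
  limit_measures f x mu -> nbhs (pairing mu phi) D ->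
  exists2 n, (N <= n)%N & D (pairing (empirical f x n) phi).
Proof.
move=> lim nD.
have [_ [[n Nn <-] Dn]] := lim
   [set (empirical f x n : borel_prob R X) | n in [set n | (N <= n)%N]] _
   ltac:(exists N => // n Nn; by exists n) (continuous_pairing nD).
by exists n.
Qed.

Lemma limit_pairing_cst (f : X -> X) x mu phi (c : R) :
  (forall n, pairing (empirical f x n) phi = c) ->
  limit_measures f x mu -> pairing mu phi = c.
Proof.
move=> h lim; apply: contrapT => ne.
have nD : nbhs (pairing mu phi) (~` [set r : R | r = c]).
  by apply: open_nbhs_nbhs; split => //; exact/closed_openC/closed_eq.
by have [n _] := limit_measures_frequently 0 lim nD; apply.
Qed.

(** The limit set is a full class rather than one point, because the topology does not separate the
    members of a class. *)
Lemma limit_measures_fixed (f : X -> X) x mu :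
  (forall n phi, pairing (empirical f x n) phi = pairing mu phi) ->
  limit_measures f x = indist mu.
Proof.
move=> h; apply/seteqP; split=> nu /=.
  by move=> lim; apply/funext => phi; apply: limit_pairing_cst lim => n.
move=> numu; apply: (@limit_measures_subseq _ _ _ id); first exact: cvg_id.
move=> phi; rewrite (_ : (fun _ => _) = cst (pairing nu phi)); first exact: cvg_cst.
by apply/funext => k; rewrite h numu.
Qed.

(** * Integrals against finitely supported measures *)

Lemma measurable_borel_cont (phi : X -> R) : continuous phi ->
  measurable_fun [set: borel X] (phi : borel X -> R).
Proof.
move=> cphi; apply: (measurability _ (RGenOpens.measurableE R)).
move=> _ [_ [a [b ->] <-]]; rewrite setTI; apply: sub_sigma_algebra.
by move/continuousP : cphi; apply; exact: interval_open.
Qed.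

(** A formula for nonnegative integrands carries over to real ones through positive and negative
    parts, whose integrals are finite sums here. *)
Lemma Rintegral_finite_support (I : finType) (m : {measure set (borel X) -> \bar R})
    (c : I -> R) (a : I -> borel X) (phi : borel X -> R) :
  (forall g : borel X -> \bar R, measurable_fun setT g -> (forall x, 0 <= g x)%E ->
     (\int[m]_x g x = \sum_i (c i)%:E * g (a i))%E) ->
  measurable_fun setT phi ->
  Rintegral m setT phi = \sum_i c i * phi (a i).
Proof.
move=> H mphi; rewrite /Rintegral integralE.
have mE : measurable_fun setT (EFin \o phi) by exact/measurable_EFinP.
rewrite !H; [|exact: measurable_funeneg|by []|exact: measurable_funepos|by []].
have ep x : ((EFin \o phi)^\+ x)%E = (Num.max (phi x) 0)%:E by rewrite funeposE/= EFin_max.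
have en x : ((EFin \o phi)^\- x)%E = (Num.max (- phi x) 0)%:E.
  by rewrite funenegE/= EFin_max EFinN.
under eq_bigr do rewrite ep -EFinM.
under [X in (_ - X)%E]eq_bigr do rewrite en -EFinM.
rewrite !sumEFin -EFinB /= -sumrB; apply: eq_bigr => i _.
rewrite -mulrBr; congr (_ * _).
have [h|h] := lerP 0 (phi (a i)).
  by rewrite (max_idPr _) ?subr0// oppr_le0.
by rewrite (max_idPl _) ?sub0r ?opprK// oppr_ge0 ltW.
Qed.

Lemma pairing_empirical (f : X -> X) x n phi :
  pairing (empirical f x n) phi = n.+1%:R^-1 * \sum_(k < n.+1) sval phi (iter k f x).
Proof.
have mphi := measurable_borel_cont (svalP phi).
rewrite /pairing mulr_sumr.
apply: (@Rintegral_finite_support 'I_n.+1 _ (fun=> n.+1%:R^-1) (fun k => iter k f x)) => //.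
move=> g mg g0; rewrite ge0_integral_mscale// ge0_integral_measure_sum//.
rewrite ge0_sume_distrr => [|i _]; last exact: integral_ge0.
by apply: eq_bigr => i _; rewrite integral_dirac// diracT mul1e.
Qed.

Lemma pairing_dirac (a : X) phi :
  pairing (\d_(a : borel X) : borel_prob R X) phi = sval phi a.
Proof.
have mphi := measurable_borel_cont (svalP phi).
rewrite /pairing (@Rintegral_finite_support unit _ (fun=> 1) (fun=> a)) //.
  by rewrite (big_pred1 tt) ?mul1r//; case.
move=> g mg g0; rewrite integral_dirac// diracT.
by rewrite (big_pred1 tt)//; case.
Qed.

Lemma pairing_mix_dirac (t : {i01 R}) (a b : X) phi :
  pairing (mix t (\d_(a : borel X)) (\d_(b : borel X)) : borel_prob R X) phi =
  t%:num * sval phi a + (1 - t%:num) * sval phi b.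
Proof.
have mphi := measurable_borel_cont (svalP phi).
rewrite /pairing (@Rintegral_finite_support bool _
  (fun i => if i then t%:num else 1 - t%:num) (fun i => if i then a else b)) //.
  by rewrite big_bool.
move=> g mg g0; rewrite ge0_integral_measure_add// !ge0_integral_mscale//.
by rewrite !integral_dirac// !diracT !mul1e big_bool.
Qed.

End WeakTopology.

(** * The subshift *)

(** The run may be preceded by further ones; the longest run gives the strongest condition. For
    [n = 0] nothing is required, as [j < 0] fails; [j = 0] is the zero that ends the run. *)
Definition admissible (R : realType) (tau : R) (x : nat -> bool) :=
  forall i n j, (forall k, (k < n)%N -> x (i + k)%N = true) ->
    x (i + n)%N = false -> j%:R < tau * n%:R -> x (i + n + j)%N = false.

Record gapshift (R : realType) (tau : R) := Gapshift {
  symb :> nat -> bool;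
  symbP : admissible tau symb }.

HB.instance Definition _ (R : realType) (tau : R) := gen_eqMixin (gapshift tau).
HB.instance Definition _ (R : realType) (tau : R) := gen_choiceMixin (gapshift tau).

Section Metric.
Context {R : realType} {tau : R}.
Local Notation X := (gapshift tau).
Implicit Types x y z : X.

Lemma gapshift_eq x y : symb x =1 symb y -> x = y.
Proof.
case: x y => [x xP] [y yP] /= /funext xy; rewrite xy in xP *.
by congr Gapshift; exact: Prop_irrelevance.
Qed.

Definition agree n x y := forall k, (k < n)%N -> x k = y k.

Lemma agree_sym n x y : agree n x y -> agree n y x.
Proof. by move=> h k /h. Qed.

Lemma agree_trans n x y z : agree n x y -> agree n y z -> agree n x z.
Proof. by move=> h h' k kn; rewrite h// h'. Qed.

Lemma agreeW n m x y : (n <= m)%N -> agree m x y -> agree n x y.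
Proof. by move=> nm h k kn; apply: h; exact: leq_trans nm. Qed.

(** The usual metric of a sequence space: [1 / (k + 1)], where [k] is the first place of
    disagreement. *)
Definition fdist x y : R :=
  if pselect (exists k, x k != y k) is left e then (ex_minn e).+1%:R^-1 else 0.

Lemma fdist_cases x y : (x = y /\ fdist x y = 0) \/
  exists k, [/\ agree k x y, x k != y k & fdist x y = k.+1%:R^-1].
Proof.
rewrite /fdist; case: pselect => [e|ne].
  right; case: ex_minnP => k xyk kmin; exists k; split=> // l lk.
  by apply/eqP/contraT => /kmin; rewrite leqNgt lk.
left; split=> //; apply: gapshift_eq => k; apply/eqP/contraT => xyk.
by exfalso; apply: ne; exists k.
Qed.

Lemma fdist_ge0 x y : 0 <= fdist x y.
Proof. by case: (fdist_cases x y) => [[_ ->]|[k [_ _ ->]]]. Qed.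

Lemma fdist_ge x y k : x k != y k -> k.+1%:R^-1 <= fdist x y.
Proof.
case: (fdist_cases x y) => [[-> _]|[l [xyl _ ->]]]; first by rewrite eqxx.
move=> xyk; rewrite lef_pV2 ?posrE// ler_nat ltnS leqNgt.
by apply/negP => /xyl/eqP; exact/negP.
Qed.

Lemma fdist_le n x y : agree n x y -> fdist x y <= n.+1%:R^-1.
Proof.
move=> xyn; case: (fdist_cases x y) => [[_ ->]//|[k [_ xyk ->]]].
rewrite lef_pV2 ?posrE// ler_nat ltnS leqNgt.
by apply/negP => /xyn/eqP; exact/negP.
Qed.

Lemma fdist_lt_agree n x y : fdist x y < n.+1%:R^-1 -> agree n.+1 x y.
Proof.
move=> h k kn; apply/eqP/contraT => /fdist_ge h'.
have := le_lt_trans h' h; rewrite ltf_pV2 ?posrE// ltr_nat ltnS.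
by rewrite leqNgt kn.
Qed.

Let fdistxx x : fdist x x = 0.
Proof. by case: (fdist_cases x x) => [[_ ->]//|[k [_]]]; rewrite eqxx. Qed.

Let fdist_eq0 x y : fdist x y = 0 -> x = y.
Proof.
case: (fdist_cases x y) => [[]//|[k [_ _ ->]]] /eqP.
by rewrite invr_eq0 pnatr_eq0.
Qed.

Let fdist_sym x y : fdist x y = fdist y x.
Proof.
wlog h : x y / fdist x y <= fdist y x.
  by move=> H; case: (leP (fdist x y) (fdist y x)) => [/H//|/ltW/H].
apply/eqP; rewrite eq_le h /=.
case: (fdist_cases y x) => [[_ ->]|[k [_ yxk ->]]]; first exact: fdist_ge0.
by apply: fdist_ge; rewrite eq_sym.
Qed.

(** Where [x] and [z] first differ, [y] differs from one of them. *)
Let fdist_triangle y x z : fdist x z <= fdist x y + fdist y z.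
Proof.
case: (fdist_cases x z) => [[_ ->]|[k [_ xzk ->]]].
  by rewrite addr_ge0 ?fdist_ge0.
have [xy|xy] := eqVneq (x k) (y k).
  by rewrite (le_trans (@fdist_ge y z k _)) ?lerDr ?fdist_ge0// -xy.
by rewrite (le_trans (@fdist_ge x y k _)) ?lerDl ?fdist_ge0.
Qed.

HB.instance Definition _ :=
  @isMetric.Build R X fdist fdistxx fdist_eq0 fdist_sym fdist_triangle.

Fact admissible_cst b : admissible tau (fun=> b).
Proof. by []. Qed.

Definition cst_pt b : X := Gapshift (@admissible_cst b).

HB.instance Definition _ := isPointed.Build X (cst_pt true).

Lemma mdistE x y : mdist x y = fdist x y. Proof. by []. Qed.

(** Lets the topological arguments below compare prefixes instead of distances. *)
Lemma nbhs_agree x (U : set X) : nbhs x U <-> exists n, agree n x `<=` U.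
Proof.
rewrite -metricType_numDomainType.filter_from_mdist_nbhs; split=> [[e /= e0 eU]|[n nU]].
  have [n ne] : exists n, n.+1%:R^-1 < e.
    exists (Num.trunc e^-1); rewrite invf_plt ?posrE//.
    exact: truncnS_gt.
  exists n => y xy; apply: eU => /=; rewrite mdistE.
  exact: le_lt_trans (fdist_le xy) ne.
exists n.+1%:R^-1 => [//=|y /=]; rewrite mdistE => /fdist_lt_agree h.
by apply: nU; exact: agreeW h.
Qed.

Lemma continuous_agree (T : topologicalType) n (g : X -> T) :
  (forall x y, agree n x y -> g x = g y) -> continuous g.
Proof.
move=> gP x U nU; apply/nbhs_agree; exists n => y /gP xy.
by rewrite /preimage /= -xy; exact: nbhs_singleton.
Qed.

Fact admissible_shift x : admissible tau (fun n => x n.+1).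
Proof. by move=> i n j; exact: (symbP (i := i.+1)). Qed.

Definition left_shift x : X := Gapshift (@admissible_shift x).

Lemma iter_shiftE n x k : iter n left_shift x k = x (n + k)%N.
Proof. by elim: n k => //= n IH k; rewrite IH addnS. Qed.

Lemma continuous_shift : continuous left_shift.
Proof.
move=> x U /nbhs_agree[n nU]; apply/nbhs_agree; exists n.+1 => y xy.
by apply: nU => k kn; exact: xy.
Qed.

(** An ultrafilter decides every symbol and so defines a limit [z]. Each instance of admissibility
    involves finitely many symbols, hence is inherited from a point sharing a long prefix with
    [z]. *)
Lemma gapshift_compact : compact [set: X].
Proof.
rewrite compact_ultra => F UF _.
pose z k := `[< F [set x : X | x k = true] >].
have Fz k : F [set x : X | x k = z k].
  rewrite /z; case: asboolP => // nF.
  have [//|] := in_ultra_setVsetC [set x : X | x k = true] UF.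
  by apply: filterS => x /= /negP/negbTE.
have FN N : F [set x : X | forall k, (k < N)%N -> x k = z k].
  elim: N => [|N IH]; first by apply: filterS filterT.
  by apply: filterS2 (Fz N) IH => x xN IH k; rewrite ltnS leq_eqVlt => /orP[/eqP->|/IH].
have zP : admissible tau z.
  move=> i n j z1 z0 jn.
  have [x xz] := filter_ex (FN (i + n + j).+1).
  rewrite -xz//; apply: (symbP (n := n)) => //.
    by move=> k kn; rewrite xz ?z1//; lia.
  by rewrite xz ?z0//; lia.
exists (Gapshift zP); split=> // U /nbhs_agree[n nU].
by apply: filterS (FN n) => x xz; apply: nU => k /xz.
Qed.

End Metric.

(** * Borel measures on the subshift *)

Section GapshiftMeasures.
Context {R : realType} {tau : R}.
Local Notation X := (gapshift tau).
Implicit Types (x y z : X) (mu nu : borel_prob R X).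

(** These are the unions of cylinders of length [n]. They are clopen, so their indicators are test
    functions and their measure depends continuously on [mu]. *)
Definition determined n (A : set X) := forall x y, agree n x y -> A x -> A y.

Lemma determined_indic n (A : set X) : determined n A ->
  continuous (\1_A : X -> R).
Proof.
move=> dA; apply: (@continuous_agree _ _ _ n) => x y xy; rewrite !indicE.
suff -> : (x \in A) = (y \in A) by [].
by apply/idP/idP => /set_mem h; apply/mem_set; apply: dA h => //; exact: agree_sym.
Qed.

Lemma determined_measurable n (A : set X) : determined n A ->
  measurable (A : set (borel X)).
Proof.
move=> dA; apply: sub_sigma_algebra; rewrite /= openE => x Ax.
by apply/nbhs_agree; exists n => y /dA; exact.
Qed.

Lemma pairing_indic n (A : set X) (dA : determined n A) mu :
  pairing mu (exist _ _ (determined_indic dA) : test_fun) = fine (mu A).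
Proof.
rewrite /pairing /Rintegral /= integral_indic ?setIT//.
exact: determined_measurable dA.
Qed.

Lemma indist_determined n (A : set X) mu nu : determined n A ->
  indist mu nu -> nu A = mu A.
Proof.
move=> dA /(congr1 (fun g => g (exist _ _ (determined_indic dA) : test_fun))).
rewrite !pairing_indic => e.
rewrite -[LHS]fineK ?e ?fineK//.
exact: fin_num_measure (determined_measurable dA).
exact: fin_num_measure (determined_measurable dA).
Qed.

(** Open sets form a generating pi-system, and each of them is an increasing union of determined
    sets, on which the two measures agree. *)
Lemma indist_borel mu nu (B : set (borel X)) : indist mu nu ->
  measurable B -> nu B = mu B.
Proof.
move=> munu mB.
apply: (@measure_unique _ R (borel X) (@open X) (fun=> setT) _ _ _ _
  (nu : {measure set (borel X) -> \bar R}) mu) => //.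
- by move=> U V; exact: openI.
- by move=> _; exact: openT.
- by rewrite bigcup_const.
- move=> U oU.
  (* The union of the cylinders of length [n] contained in [U]. *)
  pose V n : set X := [set x | agree n x `<=` U].
  have dV n : determined n (V n).
    by move=> x y xy Vx z yz; apply: Vx; exact: agree_trans yz.
  have ndV : nondecreasing_seq V.
    by move=> n m nm; apply/subsetPset => x Vx y xy; apply: Vx; exact: agreeW xy.
  have UE : U = \bigcup_n V n.
    apply/seteqP; split=> [x Ux|x [n _ Vx]]; last exact: Vx.
    have [n nU] : exists n, agree n x `<=` U.
      by apply/nbhs_agree; apply: open_nbhs_nbhs.
    by exists n.
  have mV n := determined_measurable (dV n).
  have mUV : measurable (\bigcup_n V n : set (borel X)) by exact: bigcup_measurable.
  have cmu : mu \o V @ \oo --> mu (\bigcup_n V n).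
    exact: (nondecreasing_cvg_mu (mu := mu)).
  have cnu : nu \o V @ \oo --> nu (\bigcup_n V n).
    exact: (nondecreasing_cvg_mu (mu := nu)).
  have e : nu \o V = mu \o V.
    by apply/funext => n /=; exact: indist_determined (dV n) munu.
  rewrite e in cnu; rewrite UE.
  exact: (cvg_unique (@ereal_hausdorff R) cnu cmu).
- move=> _; apply: (@le_lt_trans _ _ 1%E); last exact: ltry.
  exact: probability_le1.
Qed.

End GapshiftMeasures.

(** * Specification *)

Section Glue.
Context {R : realType} {tau : R}.
Local Notation X := (gapshift tau).
Variables (k : nat) (x : nat -> X) (a b : nat -> nat).
Hypothesis sep : forall i i', (i < i')%N -> (i' < k)%N -> ((b i).+1 < a i')%N.

(** All positions outside the intervals carry 0. By [sep] the intervals are disjoint and not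
    adjacent, so no run of ones passes from one to another. *)
Definition glue n := [exists i : 'I_k, (a i <= n <= b i)%N && x i (n - a i)%N].

Lemma glueP n : reflect
  (exists i, [/\ (i < k)%N, (a i <= n <= b i)%N & x i (n - a i)%N]) (glue n).
Proof.
apply: (iffP existsP) => [[i /andP[h1 h2]]|[i [ik h1 h2]]].
  by exists i; split.
by exists (Ordinal ik); rewrite h1.
Qed.

Lemma glueE i n : (i < k)%N -> (a i <= n <= b i)%N -> glue n = x i (n - a i)%N.
Proof.
move=> ik ni; apply/glueP/idP => [[l [lk nl xl]]|xi]; last by exists i.
have [il|li|->//] := ltngtP i l.
  by have := sep il lk; lia.
by have := sep li ik; lia.
Qed.

Hypothesis tau_gt0 : 0 < tau.
Hypothesis gap : forall i i', (i < i')%N -> (i' < k)%N ->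
  (b i).+1%:R + tau * (b i - a i).+1%:R <= (a i')%:R :> R.

(** A run of ones lies in a single interval [l]. A one that comes too early afterwards contradicts
    the admissibility of [x l] if it lies in the same interval, and [gap] if it lies in a later
    one. *)
Lemma admissible_glue : admissible tau glue.
Proof.
move=> i [|n] j ones zero jn; first by rewrite mulr0 ltrn0 in jn.
have /glueP[l [lk il _]] := ones 0%N isT.
rewrite addn0 in il.
(* The run cannot leave interval [l], since a zero follows its last position. *)
have seg t : (t < n.+1)%N -> (a l <= i + t <= b l)%N.
  elim: t => [|t IH] tn; first by rewrite addn0.
  have {}IH := IH (ltnW tn).
  have /glueP[l' [l'k il' _]] := ones _ tn.
  have [h|h|h] := ltngtP l l'; last by rewrite h.
    by have := sep h l'k; lia.
  by have := sep h lk; lia.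
have segn := seg n (ltnSn n).
apply/negbTE/negP => /glueP[l' [l'k Pl' xl']].
have [h|h|h] := ltngtP l l'.
- have := gap h l'k; rewrite leNgt => /negP; apply.
  have aP : (a l')%:R <= (i + n.+1)%:R + j%:R :> R by rewrite -natrD ler_nat; lia.
  have bP : (i + n.+1)%:R <= (b l).+1%:R :> R by rewrite ler_nat; lia.
  have lP : tau * n.+1%:R <= tau * (b l - a l).+1%:R.
    by rewrite ler_pM2l// ler_nat; lia.
  lra.
- by have := sep h lk; lia.
- subst l'.
  have e1 : (i + n.+1 - a l)%N = (i - a l + n.+1)%N by lia.
  have e2 : (i + n.+1 + j - a l)%N = (i - a l + n.+1 + j)%N by lia.
  rewrite e2 (@symbP _ _ (x l) (i - a l)%N n.+1 j) // in xl'.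
    move=> t tn; rewrite -(ones t tn) (@glueE l)//; last exact: seg.
    by congr (symb _ _); lia.
  by rewrite -zero (@glueE l)//; [congr (symb _ _); lia | lia].
Qed.

End Glue.

Section RealSequences.
Context {R : realType}.

Lemma limn_einf_ge (u : nat -> \bar R) (c : \bar R) N :
  (forall n, (N <= n)%N -> (c <= u n)%E) -> (c <= limn_einf u)%E.
Proof.
move=> h; rewrite limn_einf_lim; apply: lime_ge; first exact: is_cvg_einfs.
exists N => // n /= Nn; apply: le_ereal_inf_tmp => _ [l /= nl <-].
by apply: h; exact: leq_trans nl.
Qed.

Lemma cvg_natV : (fun n => n%:R^-1 : R) @ \oo --> (0 : R).
Proof. by rewrite -cvg_shiftS; exact: cvg_harmonic. Qed.

End RealSequences.

Section Specification.
Context {R : realType} {tau : R}.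
Hypothesis tau_gt0 : 0 < tau.
Local Notation X := (gapshift tau).
Local Notation left_shift := (@left_shift R tau).

(* To be eps-close on n iterates, n + trunc (1 / eps) symbols must agree. *)
Definition gapfun n (eps : R) :=
  (Num.trunc (tau * (n + Num.trunc eps^-1)%:R) + Num.trunc eps^-1 + 2)%N.

Lemma gapfun_spec : gap_function left_shift gapfun.
Proof.
split=> [n e _ _|n m e n0 nm e0|n e e' n0 e0 ee'|e e0 k x a b k2 ab ba gap].
- by rewrite /gapfun addn2.
- rewrite /gapfun !leq_add2r; apply: le_truncn.
  by rewrite ler_pM2l// ler_nat leq_add2r.
- have h : (Num.trunc e'^-1 <= Num.trunc e^-1)%N.
    by apply: le_truncn; rewrite lef_pV2 ?posrE// (lt_le_trans e0).
  rewrite /gapfun leq_add2r leq_add//; apply: le_truncn.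
  by rewrite ler_pM2l// ler_nat leq_add2l.
set m := Num.trunc e^-1.
have gap1 i : (i.+1 < k)%N ->
    (b i + (Num.trunc (tau * (b i - a i + 1 + m)%:R) + m + 2) <= a i.+1)%N.
  by move=> ik; have := gap i ik; have := ba i ik; rewrite /gapfun -/m; lia.
have gapi i i' : (i < i')%N -> (i' < k)%N ->
    (b i + (Num.trunc (tau * (b i - a i + 1 + m)%:R) + m + 2) <= a i')%N.
  elim: i' => // i' IH; rewrite ltnS leq_eqVlt => /orP[/eqP<-|ii'] ik.
    exact: gap1.
  apply: (leq_trans (IH ii' (ltnW ik))).
  by have := ab i' (ltnW ik); have := ba i' ik; lia.
(* Each segment is prolonged by the [m] symbols that closeness at time [b i] involves. The summand 2
   in [gapfun] covers the rounding of [trunc] and the step from [b' i] to its successor. *)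
pose b' i := (b i + m)%N.
have sep i i' : (i < i')%N -> (i' < k)%N -> ((b' i).+1 < a i')%N.
  by move=> ii' ik; have := gapi i i' ii' ik; rewrite /b'; lia.
have gapR i i' : (i < i')%N -> (i' < k)%N ->
    (b' i).+1%:R + tau * (b' i - a i).+1%:R <= (a i')%:R :> R.
  move=> ii' ik; have := gapi i i' ii' ik; rewrite -(ler_nat R) !natrD => h.
  have := truncnS_gt (tau * (b i - a i + 1 + m)%:R).
  have -> : (b' i - a i).+1 = (b i - a i + 1 + m)%N.
    by have := ab i (ltn_trans ii' ik); rewrite /b'; lia.
  by rewrite /b' -!natr1 !natrD => h'; lra.
exists (Gapshift (admissible_glue (x := x) sep tau_gt0 gapR)) => i n ik ni.
have em : m.+1%:R^-1 <= e.
  by rewrite invf_ple ?posrE// ltW// truncnS_gt.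
apply: le_trans em; apply: fdist_le => l lm.
rewrite !iter_shiftE /= (glueE x sep ik); last by rewrite /b'; lia.
by congr (symb _ _); lia.
Qed.

(** Shadow the word [1^n] and then, after a gap of exactly [M n eps], the word [01]. The first zero
    of the shadowing point ends a run of at least [n] ones, and the final one of [01] may come only
    after the forced zeros. *)
Lemma gap_function_ge M n (eps : R) : gap_function left_shift M ->
  (0 < n)%N -> 0 < eps < 1 -> tau * n%:R <= (M n eps)%:R.
Proof.
move=> [M0 _ _ spec] n0 /andP[e0 e1].
have zP : admissible tau (fun k => k != 0%N).
  move=> i [|l] j ones zero jn; first by rewrite mulr0 ltrn0 in jn.
  by move: zero; rewrite addnS.
(* The points are [1^oo] and [01^oo]; the latter is admissible because its only zero has no run
   before it. *)
pose x i : X := if i == 0%N then cst_pt true else Gapshift zP.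
pose a i := if i == 0%N then 0%N else (n.-1 + M n eps)%N.
pose b i := if i == 0%N then n.-1 else (n.-1 + M n eps).+1.
have [|||z zspec] := spec eps e0 2%N x a b isT.
- by case=> [|[|]].
- by case=> [|] //= _; rewrite /a /b /=; have := M0 n eps n0 e0; lia.
- by case=> [|] //= _; rewrite /a /b /= subn0 addn1 prednK//; lia.
have head i l : (i < 2)%N -> (a i <= l <= b i)%N -> z l = x i (l - a i)%N.
  move=> i2 il; have := zspec i l i2 il; rewrite mdistE => /le_lt_trans/(_ e1).
  rewrite -[1]invr1 => h; have := @fdist_lt_agree _ _ 0%N _ _ h 0%N isT.
  by rewrite !iter_shiftE !addn0.
have ones l : (l < n)%N -> z (0 + l)%N = true.
  by move=> ln; rewrite (head 0%N)// /a/b/=; lia.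
pose P l := ~~ z l.
have z0 : ~~ z (n.-1 + M n eps)%N.
  by rewrite (head 1%N)// /a /b /= ?subnn//; lia.
have z1 : z (n.-1 + M n eps).+1%N.
  by rewrite (head 1%N)// /a /b /= ?subSnn//; lia.
(* With [p] the first zero, the one at position [n + M n eps] gives
   [tau p <= n + M n eps - p <= M n eps], as [n <= p]. *)
have [p /negbTE zp pmin] := ex_minnP (ex_intro P _ z0).
have onesp l : (l < p)%N -> z (0 + l)%N = true.
  by move=> lp; apply/negPn/negP => /pmin; lia.
have np : (n <= p)%N.
  by rewrite leqNgt; apply/negP => /ones; rewrite add0n zp.
have pM := pmin _ z0.
have hj : ~ ((n.-1 + M n eps).+1 - p)%:R < tau * p%:R.
  move=> /(symbP onesp zp); rewrite add0n subnKC; first by rewrite z1.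
  by lia.
move/negP: hj; rewrite -leNgt => hj.
apply: (@le_trans _ _ (tau * p%:R)); first by rewrite ler_pM2l// ler_nat.
by apply: le_trans hj _; rewrite ler_nat; lia.
Qed.

Lemma gap_rate_ge M : gap_function left_shift M -> (tau%:E <= gap_rate M)%E.
Proof.
move=> spec; apply: (@le_trans _ _ (limn_einf (fun n => ((M n 2^-1)%:R / n%:R)%:E))).
  apply: (@limn_einf_ge _ _ _ 1) => n n0; rewrite lee_fin ler_pdivlMr ?ltr0n//.
  by apply: gap_function_ge => //; lra.
apply: le_ereal_sup_tmp; eexists; last exact: lexx.
by exists 2^-1 => //=; lra.
Qed.

Lemma gap_rate_gapfun : gap_rate gapfun = tau%:E.
Proof.
apply/eqP; rewrite eq_le gap_rate_ge ?andbT; last exact: gapfun_spec.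
apply: ge_ereal_sup => _ [e /= e0 <-].
pose m : R := (Num.trunc e^-1)%:R.
(* Dropping the truncation gives [gapfun n e <= tau n + c]. *)
pose c : R := tau * m + m + 2.
have cv : (fun n => tau + c * n%:R^-1 : R) @ \oo --> tau.
  rewrite -[X in _ --> X]addr0 -(mulr0 c); apply: cvgD; first exact: cvg_cst.
  by apply: cvgM; [exact: cvg_cst|exact: cvg_natV].
have cu : (fun n => (gapfun n e)%:R / n%:R : R) @ \oo --> tau.
  apply: (squeeze_cvgr _ (cvg_cst tau) cv).
  exists 1%N => // n /= n1; apply/andP; split.
    rewrite ler_pdivlMr ?ltr0n// /gapfun.
    have := truncnS_gt (tau * (n + Num.trunc e^-1)%:R).
    have : 0 <= tau * m by rewrite mulr_ge0// ltW.
    by rewrite -/m -natr1 !natrD -/m; have := ler0n R (Num.trunc e^-1); rewrite -/m; lra.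
  rewrite ler_pdivrMr ?ltr0n// mulrDl -mulrA mulVf ?pnatr_eq0; last by lia.
  rewrite /gapfun mulr1 !natrD.
  have : (Num.trunc (tau * (n + Num.trunc e^-1)%:R))%:R <= tau * (n + Num.trunc e^-1)%:R.
    by rewrite truncn_le mulr_ge0// ltW.
  by rewrite natrD /c /m; lra.
suff /cvg_limn_einf_sup[-> _] :
  (fun n => ((gapfun n e)%:R / n%:R)%:E) @ \oo --> tau%:E by [].
by apply: cvg_EFin => //; exact: nearW.
Qed.

Lemma gapshift_specification : nonuniform_specification left_shift tau.
Proof.
exists gapfun; first exact: gapfun_spec.
by split; [exact: gap_rate_gapfun|exact: gap_rate_ge].
Qed.

End Specification.

(** * Long runs of ones *)

Section Excursions.
Context {R : realType} {tau : R}.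
Local Notation X := (gapshift tau).
Local Notation left_shift := (@left_shift R tau).
Local Notation one := (@cst_pt R tau true).
Local Notation zero := (@cst_pt R tau false).
Implicit Types (x y z : X) (mu nu : borel_prob R X).

Definition zeros x N := (\sum_(k < N) ~~ x k)%N.

Lemma zerosS x N : zeros x N.+1 = (zeros x N + ~~ x N)%N.
Proof. by rewrite /zeros big_ord_recr. Qed.

Lemma zeros_run b x s n : (forall k, (k < n)%N -> x (s + k)%N = b) ->
  zeros x (s + n) = (zeros x s + ~~ b * n)%N.
Proof.
elim: n => [|n IH] h; first by rewrite addn0 muln0 addn0.
rewrite addnS zerosS h// IH; last by move=> k kn; apply: h; exact: ltnW.
by rewrite mulnS; lia.
Qed.

(* The last inequality says that the runs of ones before s have been paid for by
   zeros before s; it makes s negligible when N has few zeros. *)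
Lemma decomposition x N : 0 < tau -> exists s n j,
  [/\ N = (s + n + j)%N, forall k, (k < n)%N -> x (s + k)%N = true,
      forall k, (k < j)%N -> x (s + n + k)%N = false &
      tau * (s%:R - (zeros x s)%:R) <= (zeros x s)%:R].
Proof.
move=> tau_gt0; elim: N => [|N [s [n [j [NE ones zs pot]]]]].
  by exists 0%N, 0%N, 0%N; split=> //; rewrite /zeros big_ord0 subrr mulr0.
have [xN|/negbTE xN] := boolP (x N); last first.
  exists s, n, j.+1; split=> //; first by rewrite NE addnS.
  by move=> k; rewrite ltnS leq_eqVlt => /orP[/eqP->|/zs//]; rewrite -NE.
have [j0|j0] := posnP j.
  subst j; exists s, n.+1, 0%N; split=> //; first by lia.
  move=> k; rewrite ltnS leq_eqVlt => /orP[/eqP->|/ones//].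
  by rewrite addn0 in NE; rewrite -NE.
(* A one after zeros opens a new run, and all that precedes becomes the prefix. Admissibility gives
   [tau n <= j], so the old run is paid for by its own zeros. *)
exists N, 1%N, 0%N; split=> //; first by lia.
  by case=> // _; rewrite addn0.
have nj : tau * n%:R <= j%:R.
  rewrite leNgt; apply/negP => /(symbP ones) h.
  by move: xN; rewrite NE h// -[(s + n)%N]addn0 zs.
rewrite NE (zeros_run (b := false))// (zeros_run (b := true))//= mul0n addn0 mul1n.
by rewrite !natrD; lra.
Qed.

(** The last [l] terms are split off: there a window of length [l] sticks out of the run and only
    the crude bound [D] is available. *)
Lemma ler_sum_run (u : nat -> R) (n l : nat) (e D : R) : 0 <= e ->
  (forall k, `|u k| <= D) -> (forall k, (k + l <= n)%N -> `|u k| <= e) ->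
  `|\sum_(k < n) u k| <= e * n%:R + D * l%:R.
Proof.
move=> e0 uD ue; have D0 : 0 <= D := le_trans (normr_ge0 _) (uD 0%N).
rewrite -(big_mkord xpredT u) (big_cat_nat (n := n - l)%N)//=; last exact: leq_subr.
apply: le_trans (ler_normD _ _) _; apply: lerD.
  apply: le_trans (ler_norm_sum _ _ _) _.
  apply: (@le_trans _ _ (\sum_(0 <= k < n - l) e)).
    by rewrite !big_nat; apply: ler_sum => k /andP[_ kn]; apply: ue; lia.
  by rewrite sumr_const_nat -[e *+ _]mulr_natr ler_wpM2l// ler_nat; lia.
apply: le_trans (ler_norm_sum _ _ _) _.
apply: (@le_trans _ _ (\sum_(n - l <= k < n) D)); first exact: ler_sum.
by rewrite sumr_const_nat -[D *+ _]mulr_natr ler_wpM2l// ler_nat; lia.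
Qed.

Lemma agree_run b x s n k l : (forall k, (k < n)%N -> x (s + k)%N = b) ->
  (k + l <= n)%N -> agree l (cst_pt b) (iter (s + k)%N left_shift x).
Proof.
by move=> h kl i il; rewrite iter_shiftE -addnA h//; lia.
Qed.

(** The orbit is cut into a prefix of length [s], a run of ones and a run of zeros of about [tau]
    times its length. Near the two fixed points each term errs by [e], except for [l] terms at the
    end of each run. *)
Lemma orbit_sum_estimate (phi : X -> R) (B e : R) l x s n q : 0 < tau -> 0 <= e ->
  (forall y, `|phi y| <= B) ->
  (forall b y, agree l (cst_pt b) y -> `|phi y - phi (cst_pt b)| <= e) ->
  (forall k, (k < n)%N -> x (s + k)%N = true) ->
  (forall k, (k < q)%N -> x (s + n + k)%N = false) ->
  q%:R <= tau * n%:R <= q%:R + 1 ->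
  `|\sum_(k < s + n + q) phi (iter k left_shift x) -
    (s + n + q)%:R * ((phi one + tau * phi zero) / (1 + tau))| <=
  e * (s + n + q)%:R + B * (4 * l%:R + 4) * (s%:R + 1).
Proof.
move=> tau_gt0 e0 phiB phie ones zs /andP[q1 q2].
have B0 : 0 <= B := le_trans (normr_ge0 _) (phiB one).
have diffB y z : `|phi y - phi z| <= 2 * B.
  by have := phiB y; have := phiB z; have := ler_normB (phi y) (phi z); lra.
have S1 : `|\sum_(k < s) phi (iter k left_shift x)| <= B * s%:R.
  apply: le_trans (ler_norm_sum _ _ _) _.
  apply: (@le_trans _ _ (\sum_(k < s) B)); first exact: ler_sum.
  by rewrite sumr_const card_ord mulr_natr.
have S2 := @ler_sum_run (fun k => phi (iter (s + k) left_shift x) - phi one) n l e (2 * B) e0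
  (fun k => diffB _ _) (fun k kl => phie true _ (agree_run ones kl)).
have S3 := @ler_sum_run (fun k => phi (iter (s + n + k) left_shift x) - phi zero) q l e (2 * B) e0
  (fun k => diffB _ _) (fun k kl => phie false _ (agree_run zs kl)).
rewrite !sumrB !sumr_const !card_ord in S2 S3.
rewrite -[_ one *+ _]mulr_natl in S2; rewrite -[_ zero *+ _]mulr_natl in S3.
rewrite !big_split_ord /=.
set A1 := \sum_(i < s) _ in S1 *; set A2 := \sum_(i < n) _ in S2 *.
set A3 := \sum_(i < q) _ in S3 *.
set c1 := phi one in S2 *; set c0 := phi zero in S3 *.
have t1 : 0 < 1 + tau by rewrite addr_gt0.
have h1 := phiB one; have h0 := phiB zero; rewrite -/c1 -/c0 in h1 h0.
have h10 := diffB one zero; rewrite -/c1 -/c0 in h10.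
clearbody A1 A2 A3 c1 c0.
(* [E] is the error of replacing [tau n] by the integer [q], and [F] is the share of the prefix in
   the target value. *)
have [E EE] : exists E, E = (tau * n%:R - q%:R) * (c1 - c0) / (1 + tau) by eexists.
have [F FE] : exists F, F = s%:R * ((c1 + tau * c0) / (1 + tau)) by eexists.
have -> : A1 + A2 + A3 - (s + n + q)%:R * ((c1 + tau * c0) / (1 + tau)) =
   A1 + (A2 - n%:R * c1) + (A3 - q%:R * c0) + (E - F).
  by rewrite EE FE !natrD; field; exact: lt0r_neq0.
have Eb : `|E| <= 2 * B.
  rewrite EE !normrM normfV (gtr0_norm t1) ler_pdivrMr//.
  rewrite (ger0_norm (x := tau * _ - _)) ?subr_ge0//.
  apply: (@le_trans _ _ (1 * (2 * B))); last first.
    by rewrite mul1r ler_peMr//; lra.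
  by rewrite ler_pM ?subr_ge0//; lra.
have Fb : `|F| <= s%:R * B.
  rewrite FE normrM (ger0_norm (x := s%:R))// ler_wpM2l//.
  rewrite normrM normfV (gtr0_norm t1) ler_pdivrMr//.
  apply: le_trans (ler_normD _ _) _; rewrite normrM (gtr0_norm tau_gt0).
  by rewrite mulrDr mulr1 lerD// [B * tau]mulrC ler_wpM2l// ltW.
have T := ler_normD (A1 + (A2 - n%:R * c1) + (A3 - q%:R * c0)) (E - F).
have T1 := ler_normD (A1 + (A2 - n%:R * c1)) (A3 - q%:R * c0).
have T2 := ler_normD A1 (A2 - n%:R * c1).
have T3 := ler_normB E F.
have sl : 0 <= B * s%:R * l%:R by rewrite !mulr_ge0.
have s0 : 0 <= e * s%:R by rewrite !mulr_ge0.
have Bl : 0 <= B * s%:R by rewrite !mulr_ge0.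
have es : 0 <= B * l%:R by rewrite mulr_ge0.
apply: le_trans T _; rewrite !natrD; lra.
Qed.

End Excursions.

(** * Accumulation points forced by long runs *)

Section LimitMeasures.
Context {R : realType} {tau : R}.
Local Notation X := (gapshift tau).
Local Notation left_shift := (@left_shift R tau).
Local Notation one := (@cst_pt R tau true).
Local Notation zero := (@cst_pt R tau false).
Implicit Types (x y z : X) (mu nu : borel_prob R X).

Lemma determined_head : determined 1 [set y : X | y 0%N = false].
Proof. by move=> x y xy /=; rewrite xy. Qed.

Lemma pairing_zeros x n :
  pairing (empirical left_shift x n) (exist _ _ (determined_indic determined_head) : test_fun) =
  (zeros x n.+1)%:R / n.+1%:R.
Proof.
rewrite pairing_empirical mulrC /zeros natr_sum; congr (_ / _).
apply: eq_bigr => k _ /=; rewrite indicE; congr (_%:R).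
have xkE : iter k left_shift x 0%N = x k by rewrite iter_shiftE addn0.
by case xk : (x k); [rewrite memNset//= xkE xk|rewrite mem_set//= xkE].
Qed.

(** The bound [s * m <= n] makes the prefix negligible as [m] grows; the zero at [s + n] triggers
    the forced zeros. *)
Definition long_run x m s n := [/\ (m <= n)%N, (s * m <= n)%N,
  forall k, (k < n)%N -> x (s + k)%N = true & x (s + n)%N = false].

(** The Dirac mass at [1^oo] ignores the cylinder of 0, so some long prefix has few zeros. In its
    decomposition [s] and [j] are bounded by multiples of the number of zeros, which leaves a
    dominant run. *)
Lemma long_runs x m : 0 < tau ->
  limit_measures left_shift x (\d_(one : borel X) : borel_prob R X) ->
  (forall N, exists2 k, (N <= k)%N & x k = false) ->
  exists s n, long_run x m s n.
Proof.
move=> t0 lim inf0.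
(* With [Z] zeros up to [N], [s <= (1 + 1/tau) Z] and [j <= Z]; so [Z D < N] yields
   [2 (m + 1) (s + j) <= N]. *)
pose D : R := 2 * (2 + tau^-1) * m.+1%:R.
have D0 : 0 < D by rewrite !mulr_gt0// addr_gt0 ?invr_gt0.
have [N Nm zN] : exists2 N, (2 * m <= N)%N & (zeros x N)%:R * D < N%:R.
  have nD : nbhs (pairing (\d_(one : borel X) : borel_prob R X)
      (exist _ _ (determined_indic determined_head) : test_fun)) [set r : R | r < D^-1].
    rewrite pairing_dirac /= indicE memNset//.
    by apply: open_nbhs_nbhs; split; [exact: open_lt|rewrite /= invr_gt0].
  have [n nm /=] := limit_measures_frequently (2 * m) lim nD.
  rewrite pairing_zeros => h; exists n.+1; first exact: leqW.
  by move: h; rewrite ltr_pdivrMr ?ltr0n// mulrC ltr_pdivlMr.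
have [s [n [j [NE ones zs pot]]]] := decomposition x N t0.
have zsN : (zeros x s + j <= zeros x N)%N.
  rewrite NE (zeros_run (b := false))// (zeros_run (b := true))//=; lia.
have sb : s%:R <= (1 + tau^-1) * (zeros x N)%:R.
  have h1 : s%:R - (zeros x s)%:R <= tau^-1 * (zeros x s)%:R.
    by rewrite [leRHS]mulrC ler_pdivlMr// mulrC.
  have h2 : (zeros x s)%:R <= (zeros x N)%:R :> R by rewrite ler_nat; lia.
  have h3 : tau^-1 * (zeros x s)%:R <= tau^-1 * (zeros x N)%:R.
    by rewrite ler_pM2l ?invr_gt0.
  by lra.
have jb : j%:R <= (zeros x N)%:R :> R by rewrite ler_nat; lia.
have tot : 2 * m.+1%:R * (s%:R + j%:R) <= N%:R :> R.
  apply: le_trans (ltW zN); rewrite mulrC /D.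
  have -> : (zeros x N)%:R * (2 * (2 + tau^-1) * m.+1%:R) =
    ((1 + tau^-1) * (zeros x N)%:R + (zeros x N)%:R) * (2 * m.+1%:R) by ring.
  by rewrite ler_pM2r ?mulr_gt0// lerD.
rewrite -natrD -!natrM ler_nat in tot.
pose P k := (s + n <= k)%N && ~~ x k.
have [k0 k0n xk0] := inf0 (s + n)%N.
have Pk0 : P k0 by rewrite /P k0n xk0.
(* If [j = 0] the run may continue beyond the prefix; it is prolonged to the next zero [e]. *)
have [e /andP[ne xe] emin] := ex_minnP (ex_intro P _ Pk0).
exists s, (e - s)%N; split; [nia|nia| |].
  move=> k ke; have [kn|nk] := ltnP k n; first exact: ones.
  apply/negPn/negP => xk; have := emin (s + k)%N.
  by rewrite /P xk leq_add2l nk => /(_ isT); lia.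
by rewrite subnKC ?(negbTE xe)//; lia.
Qed.

(** Averages are taken up to the end of about [tau n] forced zeros, when ones and zeros stand in the
    ratio [1 : tau] up to a negligible prefix. *)
Lemma cvg_long_runs x (t : {i01 R}) : 0 < tau -> t%:num = (1 + tau)^-1 ->
  (forall m, exists s n, long_run x m s n) ->
  limit_measures left_shift x
    (mix t (\d_(one : borel X)) (\d_(zero : borel X)) : borel_prob R X).
Proof.
move=> t0 tE runs.
have t1 : 0 < 1 + tau by lra.
have [s sP] := choice (fun m => runs m.+1).
have [n snP] := choice sP.
pose q m := Num.trunc (tau * (n m)%:R).
pose W m := (s m + n m + q m)%N.
have W0 m : W m = (W m).-1.+1.
  by have [h _ _ _] := snP m; rewrite prednK// /W; lia.
(* The predecessor compensates for [empirical] averaging over one more point than its index. *)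
apply: (@limit_measures_subseq _ _ _ _ _ (fun m => (W m).-1)).
  move=> A [N _ NA]; exists N => // m /= Nm; apply: NA => /=.
  by have [h _ _ _] := snP m; rewrite /W; lia.
move=> [phi cphi]; rewrite pairing_mix_dirac /= tE.
have -> : (1 + tau)^-1 * phi one + (1 - (1 + tau)^-1) * phi zero =
    (phi one + tau * phi zero) / (1 + tau).
  by field; exact: lt0r_neq0.
have [B phiB] : exists B, forall y, `|phi y| <= B.
  have : bounded_set (phi @` [set: X]).
    apply: compact_bounded; apply: continuous_compact; last exact: gapshift_compact.
    exact: continuous_subspaceT.
  case=> M [_ MP]; exists (M + 1) => y.
  by apply: (MP (M + 1)); [rewrite ltrDl|exists y].
have B0 : 0 <= B := le_trans (normr_ge0 _) (phiB one).
apply/cvgrPdist_le => e e0.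
have e20 : 0 < e / 2 by rewrite divr_gt0.
have near_pt b : exists l, forall y, agree l (cst_pt b) y ->
    `|phi y - phi (cst_pt b)| <= e / 2.
  have /cvgrPdist_le/(_ _ e20)/nbhs_agree[l lP] := cphi (cst_pt b).
  by exists l => y /lP; rewrite distrC.
have [l1 l1P] := near_pt true; have [l0 l0P] := near_pt false.
pose l := maxn l1 l0.
have lP b y : agree l (cst_pt b) y -> `|phi y - phi (cst_pt b)| <= e / 2.
  case: b => h; [apply: l1P|apply: l0P]; apply: agreeW h.
    exact: leq_maxl.
  exact: leq_maxr.
pose C := B * (4 * l%:R + 4).
have C0 : 0 <= C by rewrite mulr_ge0// addr_ge0// mulr_ge0.
exists (Num.trunc (4 * C / e)) => // m /= Nm.
have mC : 4 * C <= e * m.+1%:R.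
  rewrite [leRHS]mulrC -ler_pdivrMr//; apply: (le_trans (ltW (truncnS_gt _))).
  by rewrite ler_nat.
have [mn smn ones zn] := snP m.
have zs k : (k < q m)%N -> x (s m + n m + k)%N = false.
  move=> kq; apply: (symbP (n := n m)) => //.
  apply: (@lt_le_trans _ _ (q m)%:R); first by rewrite ltr_nat.
  by rewrite truncn_le mulr_ge0// ltW.
have qb : (q m)%:R <= tau * (n m)%:R <= (q m)%:R + 1.
  rewrite truncn_le mulr_ge0//=; last exact: ltW.
  by rewrite natr1 ltW// truncnS_gt.
have := orbit_sum_estimate t0 (ltW e20) phiB lP ones zs qb.
rewrite -/(W m) -/C pairing_empirical -W0 /=.
set S := \sum_(k < _) _; set L := (phi one + _) / _ => est.
have Wp : 0 < (W m)%:R :> R by rewrite W0.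
have -> : L - (W m)%:R^-1 * S = (W m)%:R^-1 * ((W m)%:R * L - S).
  by rewrite mulrBr mulKf ?gt_eqF.
rewrite normrM normfV (gtr0_norm Wp) mulrC ler_pdivrMr// distrC.
apply: le_trans est _.
(* Both [s m * (m + 1)] and [m + 1] are at most [n m]. Together with [mC] this bounds the prefix
   error by half of [e * W m]. *)
have h1 : ((s m)%:R + 1) * m.+1%:R <= 2 * (W m)%:R :> R.
  by rewrite natr1 -natrM -[2]/(2%:R) -natrM ler_nat /W; nia.
have h2 : C * ((s m)%:R + 1) * (4 * m.+1%:R) <= e * (W m)%:R / 2 * (4 * m.+1%:R).
  have : 4 * C * (((s m)%:R + 1) * m.+1%:R) <= e * m.+1%:R * (2 * (W m)%:R).
    by apply: ler_pM => //; rewrite mulr_ge0// ?addr_ge0.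
  by lra.
rewrite ler_pM2r in h2; last by rewrite mulr_gt0.
lra.
Qed.

End LimitMeasures.

(** * Invariant measures, the convex hull and scrambled pairs *)

Lemma continuous_borel_preimage (X Y : ptopologicalType) (f : X -> Y)
    (B : set (borel Y)) : continuous f -> measurable B ->
  measurable (f @^-1` B : set (borel X)).
Proof.
move=> cf mB; rewrite -[f @^-1` B]setTI.
have : measurable_fun [set: borel X] (f : borel X -> borel Y).
  apply: (measurability (@open Y : set (set (borel Y))) erefl) => _ [U oU <-]; rewrite setTI.
  by apply: sub_sigma_algebra; move/continuousP : cf; exact.
by apply.
Qed.

Section GapshiftDynamics.
Context {R : realType} {tau : R}.
Local Notation X := (gapshift tau).
Local Notation left_shift := (@left_shift R tau).
Local Notation one := (@cst_pt R tau true).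
Local Notation zero := (@cst_pt R tau false).
Local Notation delta a := (\d_(a : borel X) : borel_prob R X).
Implicit Types (x y z : X) (mu nu : borel_prob R X).

Lemma iter_shift_cst b n : iter n left_shift (cst_pt b) = cst_pt b.
Proof. by apply: gapshift_eq => k; rewrite iter_shiftE. Qed.

Lemma limit_measures_cst_pt b :
  limit_measures left_shift (cst_pt b) = indist (delta (cst_pt b)).
Proof.
apply: limit_measures_fixed => n phi; rewrite pairing_empirical pairing_dirac.
under eq_bigr do rewrite iter_shift_cst.
by rewrite sumr_const card_ord -[X in _ * X]mulr_natl mulrA mulVf ?mul1r.
Qed.

Lemma dirac_borelE x (A : set (borel X)) : delta x A = (x \in A)%:R%:E.
Proof. exact: diracE. Qed.

Lemma mix_borelE (t : {i01 R}) mu nu (A : set (borel X)) :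
  (mix t mu nu : borel_prob R X) A =
  (t%:num%:E * mu A + (1 - t%:num)%:E * nu A)%E.
Proof. exact: measure_addE. Qed.

Lemma dirac_cst_pt_invariant b : invariant_measures left_shift (delta (cst_pt b)).
Proof.
move=> B mB; rewrite !dirac_borelE; congr (_%:R%:E).
suff -> : (cst_pt b \in left_shift @^-1` B) = (cst_pt b \in B) by [].
by apply/idP/idP => /set_mem h; apply/mem_set;
  move: h; rewrite /preimage /= -[left_shift _]/(iter 1 left_shift _) iter_shift_cst.
Qed.

Lemma mix_invariant (t : {i01 R}) mu nu : invariant_measures left_shift mu ->
  invariant_measures left_shift nu ->
  invariant_measures left_shift (mix t mu nu : borel_prob R X).
Proof.
by move=> imu inu B mB; rewrite !mix_borelE imu// inu.
Qed.

Lemma indist_invariant mu : invariant_measures left_shift mu ->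
  indist mu `<=` invariant_measures left_shift.
Proof.
move=> imu nu numu B mB; rewrite !(indist_borel numu)//; first exact: imu.
exact: (continuous_borel_preimage continuous_shift).
Qed.

Definition zero_block c : set X := [set y | forall k, (k < c)%N -> y k = false].

Lemma determined_zero_block c : determined c (zero_block c).
Proof. by move=> x y xy h k kc; rewrite -xy ?h. Qed.

(** The measure of a clopen set is a weak* continuous function; with [convex_null], this confines
    closed convex hulls. *)
Lemma closed_null n (A : set X) : determined n A ->
  closed [set mu : borel_prob R X | mu A = 0%E].
Proof.
move=> dA.
have -> : [set mu : borel_prob R X | mu A = 0%E] =
  (fun mu => pairing mu (exist _ _ (determined_indic dA) : test_fun)) @^-1` [set r : R | r = 0].
  apply/seteqP; split=> mu /=; rewrite pairing_indic; first by move=> ->.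
  move=> h; rewrite -[mu A]fineK ?h//.
  exact: fin_num_measure (determined_measurable dA).
set phi : test_fun := exist _ _ _.
have /continuous_closedP cphi := @continuous_pairing R X phi.
apply: cphi; exact: closed_eq.
Qed.

Lemma convex_null (A : set X) : convex_measures [set mu : borel_prob R X | mu A = 0%E].
Proof.
by move=> t mu nu /= muA nuA; rewrite mix_borelE muA nuA !mule0 adde0.
Qed.

Lemma limit_measures_null (f : X -> X) x n (A : set X) : determined n A ->
  (forall k, ~ A (iter k f x)) ->
  limit_measures f x `<=` [set mu : borel_prob R X | mu A = 0%E].
Proof.
move=> dA nA mu lim /=.
have : pairing mu (exist _ _ (determined_indic dA) : test_fun) = 0.
  apply: limit_pairing_cst lim => m; rewrite pairing_empirical big1 ?mulr0// => k _ /=.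
  by rewrite indicE memNset.
rewrite pairing_indic => h; rewrite -[mu A]fineK ?h//.
exact: fin_num_measure (determined_measurable dA).
Qed.

(** In [(1 0^(c-1))^oo] all runs of ones have length 1, and [c - 1 > tau] zeros follow each. *)
Lemma admissible_periodic c : tau + 1 < c%:R -> (1 < c)%N ->
  admissible tau (fun k => k %% c == 0)%N.
Proof.
move=> tc c1 i [|[|n]] j ones zr jn; first by rewrite mulr0 ltrn0 in jn.
  have := ones 0%N isT; rewrite addn0 => /eqP ic.
  rewrite mulr1 in jn.
  have jc : (j.+1 < c)%N by rewrite -(ltr_nat R) -natr1; lra.
  apply/negbTE; rewrite -addnA add1n -modnDml ic add0n modn_small//.
have := ones 0%N isT; have := ones 1%N isT; rewrite addn0 => /eqP h1 /eqP h0.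
by move: h1; rewrite -modnDml h0 add0n modn_small.
Qed.

(** The orbits coincide from time [N] on, so beyond time [2 N] they are close at least half of the
    time, for every threshold [t]. *)
Lemma eventually_one_not_DC1 x y :
  (exists N, forall k, (N <= k)%N -> x k = true) ->
  (exists N, forall k, (N <= k)%N -> y k = true) -> ~ DC1_scrambled left_shift x y.
Proof.
move=> [Nx xN] [Ny yN] [_ [t t0 t0P]].
pose N := maxn Nx Ny.
have xy j : (N <= j)%N -> mdist (iter j left_shift x) (iter j left_shift y) < t.
  move=> Nj; have -> : iter j left_shift x = iter j left_shift y.
    by apply: gapshift_eq => k; rewrite !iter_shiftE xN ?yN//; lia.
  by rewrite mdistxx.
suff : (2^-1%:E <= limn_einf (close_frequency left_shift x y t))%E.
  by rewrite t0P lee_fin; lra.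
apply: (@limn_einf_ge _ _ _ (2 * N).+1) => n Nn.
rewrite lee_fin ler_pdivlMr ?ltr0n; last by lia.
set P := [pred _ | _].
have cP : (#|[predC P]| <= N)%N.
  apply: (@leq_trans #|[pred j : 'I_n | (j < N)%N]|).
    apply: subset_leq_card; apply/fintype.subsetP => j; rewrite !inE -leNgt ltnNge.
    by apply: contraTN => /xy; rewrite -ltNge.
  by rewrite -sum1_card -(big_ord_widen _ (fun=> 1%N)) ?sum1_card ?card_ord//; lia.
have nP : (n <= 2 * #|P|)%N.
  have cE : (#|P| + #|[predC P]|)%N = n := etrans (cardC P) (card_ord n).
  by lia.
by rewrite -(ler_nat R) natrM in nP; lra.
Qed.


Definition periodic_pt (c : nat) (tc : tau + 1 < c%:R) (c1 : (1 < c)%N) : X :=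
  Gapshift (admissible_periodic tc c1).

End GapshiftDynamics.

(** * The example and its properties *)

Theorem theorem5 (R : realType) (tau : R) (tau_gt0 : 0 < tau) :
  exists (X : pmetricType R) (f : X -> X),
    [/\ dynamical_system f,
        nonuniform_specification f tau &
        exists (K L : set (borel_prob R X)) (p0 p1 : X),
        let C := closed_convex_hull
          (K `|` limit_measures f p0 `|` limit_measures f p1) in
        [/\ [/\ [/\ K !=set0, compact K, closed K & K `<=` invariant_measures f],
                [/\ L !=set0, compact L, closed L & L `<=` invariant_measures f],
                K `&` L = set0,
                distal_pair f p0 p1 &
                exists (I : Type) (Ki : I -> set (borel_prob R X)),
                  K = \bigcup_i Ki i /\
                  forall i, [/\ Ki i !=set0, connected (Ki i), closed (Ki i) &
                                saturated_set f (Ki i) !=set0]],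
            (forall mu nu, C mu -> L nu ->
               ((tau / (1 + tau))%:E <= tv_dist mu nu)%E) /\
            (exists mu nu, [/\ C mu, L nu &
               tv_dist mu nu = (tau / (1 + tau))%:E]) &
            let S := supersaturated_set f K `\`
              \bigcup_(nu in L) supersaturated_set f [set nu] in
            forall x y, S x -> S y -> ~ DC1_scrambled f x y]].
Proof.
pose X := gapshift tau; pose f : X -> X := left_shift (tau := tau).
pose one : X := cst_pt true; pose zero : X := cst_pt false.
pose d1 : borel_prob R X := \d_(one : borel X).
pose d0 : borel_prob R X := \d_(zero : borel X).
have t1 : 0 < 1 + tau by rewrite addr_gt0.
have ti0 : 0 <= (1 + tau)^-1 by rewrite invr_ge0 ltW.
have ti1 : (1 + tau)^-1 <= 1 by rewrite invf_le1//; lra.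
pose t : {i01 R} := Itv01 ti0 ti1.
have tE : t%:num = (1 + tau)^-1 by [].
have tE' : 1 - t%:num = tau / (1 + tau).
  by rewrite tE; field; exact: lt0r_neq0.
pose nu0 : borel_prob R X := mix t d1 d0.
pose c := (Num.trunc tau).+3.
have c1 : (1 < c)%N by [].
have tc : tau + 1 < c%:R.
  have := truncnS_gt tau; rewrite /c => h.
  by rewrite -2!natr1; lra.
pose p1 := periodic_pt tc c1.
(* A closed convex set that contains the hull and excludes [nu0]. *)
pose H : set (borel_prob R X) := [set mu | mu (zero_block c) = 0%E].
have dzb := @determined_zero_block R tau c.
have not_zero_block_one : ~ zero_block c one by move/(_ 0%N isT).
have zero_block_zero : zero_block c zero by [].
have d1H : H d1 by rewrite /H /= dirac_borelE memNset.
have K_H : indist d1 `<=` H.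
  by move=> mu mu1; rewrite /H /= (indist_determined dzb mu1).
have limE : limit_measures f one = indist d1 by exact: limit_measures_cst_pt.
pose A := indist d1 `|` limit_measures f one `|` limit_measures f p1.
have hull_H : closed_convex_hull A `<=` H.
  apply: smallest_sub.
    by split; [exact: closed_null dzb|exact: convex_null].
  rewrite /A limE setUid => mu [/K_H//|].
  apply: (limit_measures_null dzb) => k h.
  (* The offset from [k] to the next multiple of [c], where [p1] has a one; so [p1] contains no
     block [0^c]. *)
  have := h ((c - k %% c) %% c)%N; rewrite ltn_mod => /(_ isT).
  rewrite iter_shiftE /= => /negbT; rewrite modnDmr -modnDml subnKC ?modnn//.
  by rewrite ltnW// ltn_mod.
have hull_d1 : closed_convex_hull A d1.
  by apply: sub_gen_smallest; left; left.
have lower mu nu : closed_convex_hull A mu -> indist nu0 nu ->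
    ((tau / (1 + tau))%:E <= tv_dist mu nu)%E.
  move=> /hull_H muH nuL; apply: le_ereal_sup_tmp.
  exists `|mu (zero_block c) - nu (zero_block c)|%E.
    by exists (zero_block c) => //; exact: determined_measurable dzb.
  rewrite muH (indist_determined dzb nuL) sub0e abseN mix_borelE !dirac_borelE.
  rewrite memNset// mem_set// mule0 mule1 add0e tE' abse_EFin lee_fin.
  exact: ler_norm.
have SxE x : supersaturated_set f (indist d1) x ->
    ~ (\bigcup_(nu in indist nu0) supersaturated_set f [set nu]) x ->
    exists N, forall k, (N <= k)%N -> x k = true.
  (* A point with infinitely many zeros that accumulates at [d1] also accumulates at [nu0]. *)
  move=> xK xL; apply: contrapT => nev; apply: xL; exists nu0 => // _ ->.
  apply: cvg_long_runs => // m; apply: long_runs => //; first exact: xK.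
  move=> N; apply: contrapT => h; apply: nev; exists N => k Nk.
  by apply/negPn/negP => /negbTE xk; apply: h; exists k.
have id1 : invariant_measures f d1 by exact: dirac_cst_pt_invariant.
have id0 : invariant_measures f d0 by exact: dirac_cst_pt_invariant.
have inu0 : invariant_measures f nu0 by exact: mix_invariant.
exists X, f; split.
- split; [exact: gapshift_compact| |exact: continuous_shift].
  by exists one, zero => /(congr1 (fun x : X => x 0%N)).
- exact: gapshift_specification.
(* Whole classes are taken, so that [K] and [L] are closed. *)
exists (indist d1), (indist nu0), one, p1 => /=; split.
- split.
  + split; [by exists d1|exact: indist_compact|exact: indist_closed|].
    exact: indist_invariant.
  + split; [by exists nu0|exact: indist_compact|exact: indist_closed|].
    exact: indist_invariant.
  + apply/seteqP; split=> // mu [mu1 munu].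
    have := indist_determined dzb mu1; rewrite (indist_determined dzb munu).
    rewrite mix_borelE !dirac_borelE memNset// mem_set// mule0 mule1 add0e tE' => -[] h.
    by have := divr_gt0 tau_gt0 t1; rewrite h ltxx.
  + apply: (@lt_le_trans _ _ 2^-1); first by rewrite invr_gt0.
    apply: lb_le_inf; first by exists (mdist (iter 0 f one) (iter 0 f p1)); exists 0%N.
    move=> _ [n _ <-]; rewrite mdistE.
    (* Of two consecutive symbols of [p1] at least one is 0, which keeps the orbits at distance at
       least 1/2. *)
    have [k k2 h] : exists2 k, (k < 2)%N & iter n f one k != iter n f p1 k.
      have [nc|nc] := boolP (n %% c == 0)%N.
        exists 1%N => //; rewrite !iter_shiftE /= -modnDml (eqP nc) add0n.
        by rewrite modn_small.
      by exists 0%N => //; rewrite !iter_shiftE /= addn0 (negbTE nc).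
    apply: le_trans (fdist_ge h).
    by rewrite lef_pV2 ?posrE// ler_nat.
  + exists unit, (fun=> indist d1); split; first by rewrite bigcup_const//; exists tt.
    move=> _; split; [by exists d1|exact: indist_connected|exact: indist_closed|].
    by exists one; exact: limE.
- split; first exact: lower.
  exists d1, nu0; split=> //; apply/eqP; rewrite eq_le; apply/andP; split; last exact: lower.
  (* For every [B], the difference of [d1] and [nu0] is [tau / (1 + tau)] times that of the two
     Dirac masses, which is at most 1 in absolute value. *)
  apply: ge_ereal_sup => _ [B mB <-].
  rewrite mix_borelE !dirac_borelE [leLHS](_ : _ = `|(one \in B)%:R -
    (t%:num * (one \in B)%:R + (1 - t%:num) * (zero \in B)%:R)|%:E)// lee_fin.
  have -> : (one \in B)%:R - (t%:num * (one \in B)%:R + (1 - t%:num) * (zero \in B)%:R) =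
    (1 - t%:num) * ((one \in B)%:R - (zero \in B)%:R) by ring.
  have tp : 0 <= tau / (1 + tau) by rewrite divr_ge0// ltW.
  rewrite tE' normrM ger0_norm// -[leRHS]mulr1 ler_wpM2l//.
  by case: (_ \in _); case: (_ \in _); rewrite ?subrr ?subr0 ?sub0r ?normrN ?normr1 ?normr0.
- move=> x y [xK xL] [yK yL]; apply: eventually_one_not_DC1.
    exact: SxE xK xL.
  exact: SxE yK yL.
Qed.
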